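(* Let $\mathbb{K}$ be an arbitrary field and let $A$ be an arbitrary algebra over $\mathbb{K}$ (of arbitrary dimension, with no identity assumed for its product). Then $A$ is semisimple if and only if ${\rm Ann}(A)=0$ and $A$ admits a semi-division linear basis.
   Context: An algebra over a field $\mathbb{K}$ is a $\mathbb{K}$-vector space $A$ (of arbitrary, possibly infinite, dimension) endowed with a bilinear map $A\times A\to A$, $(x,y)\mapsto xy$, called the product; no identity (associativity, commutativity, Jacobi, existence of a unit, etc.) is assumed. Ideals are two-sided: an ideal is a linear subspace $I\subset A$ with $IA\subset I$ and $AI\subset I$. For $c\in A$, $\mathcal{I}(c)$ denotes the ideal of $A$ generated by $c$. The algebra $A$ is simple if its product is non-zero and its only ideals are $\{0\}$ and $A$. The algebra $A$ is semisimple if it can be expressed as a direct sum of simple ideals (the family of summands may be infinite), a simple ideal being an ideal that is simple as an algebra. The annihilator of $A$ is ${\rm Ann}(A)=\{x\in A: xA=Ax=0\}$. Let $\mathcal{B}=\{e_i: i\in I\}$ be a linear (Hamel) basis of $A$. For $e_i\in\mathcal{B}$ let $$\mathcal{S}_{e_i}:=\{e_j\in\mathcal{B}: e_ie_j\neq 0\}\cup\{e_k\in\mathcal{B}: e_ke_i\neq 0\},$$ and let $\mathcal{M}_{e_i}$ be the linear subspace of $A$ generated by $\mathcal{S}_{e_i}$ (with $\mathcal{M}_{e_i}=\{0\}$ if $\mathcal{S}_{e_i}=\emptyset$). $\mathcal{B}$ is a weak-division basis if for any $e_i\in\mathcal{B}$ and $x\in\mathcal{M}_{e_i}$ such that $0\neq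 e_ix=c$ or $0\neq xe_i=c$, we have $e_i,x\in\mathcal{I}(c)$. For $e_i\in\mathcal{B}$ let $p_{e_i}:A\to\mathbb{K}$ be the linear map giving the coordinate along $e_i$ with respect to $\mathcal{B}$, and let $$\mathcal{P}_{e_i}:=\{e_j\in\mathcal{B}: p_{e_i}(e_je_r)\neq 0 \text{ for some } e_r\in\mathcal{B}\}\cup\{e_k\in\mathcal{B}: p_{e_i}(e_se_k)\neq 0 \text{ for some } e_s\in\mathcal{B}\},$$ $$\mathcal{P}_{e_i}\mathcal{P}_{e_i}:=\{e_je_k: e_j,e_k\in\mathcal{P}_{e_i}\}\subset A.$$ $\mathcal{B}$ is a semi-division basis if it is a weak-division basis and, for any $e_i\in\mathcal{B}$, whenever $b\in\mathcal{P}_{e_i}\mathcal{P}_{e_i}$ and $e_j\in\mathcal{S}_{e_i}$ are such that $0\neq be_j=c$ or $0\neq e_jb=c$, we have $e_j,b\in\mathcal{I}(c)$. *)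

(* Defs.v *)
From HB Require Import structures.
From mathcomp Require Import all_boot all_order all_algebra.
From mathcomp Require Import mathcomp_extra boolp classical_sets functions.
From mathcomp Require Import cardinality fsbigop.

Set Implicit Arguments.
Unset Strict Implicit.
Unset Printing Implicit Defensive.

Import GRing.Theory.

Local Open Scope classical_set_scope.
Local Open Scope ring_scope.

(* MathComp: the product of an algebra is the argument [mul]; subspaces, ideals
   and bases are classical sets of elements of [A]. *)

Section LinearAlgebra.
Variables (K : fieldType) (A : lmodType K).
Implicit Types (S B : set A) (c : A -> K) (u x : A).

Definition is_subspace S : Prop :=
  [/\ S 0, (forall x y, S x -> S y -> S (x + y)) &
      (forall (a : K) x, S x -> S (a *: x))].

Definition lin_span S : set A := smallest is_subspace S.

(* [c] is a finitely supported family of coefficients on [B], extended by 0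
   outside [B]; without [finite_set], [\sum_(v \in B)] would be 0 by
   convention on infinite supports. *)
Definition lin_comb B c x : Prop :=
  [/\ [set v | c v != 0] `<=` B, finite_set [set v | c v != 0] &
      x = \sum_(v \in B) c v *: v].

Definition lin_indep B : Prop := forall c, lin_comb B c 0 -> c = (fun=> 0).

Definition is_basis B : Prop := lin_indep B /\ lin_span B = setT.

(* The choice made by [xget] is irrelevant when [B] is a basis: the family [c]
   then exists and is unique. *)
Definition coord B u x : K := xget (fun=> 0) [set c | lin_comb B c x] u.

End LinearAlgebra.

Section Algebra.
Variables (K : fieldType) (A : lmodType K) (mul : A -> A -> A).
Implicit Types (S J B : set A) (b c u v w x y : A).

(* [J] is a two-sided ideal of the subalgebra [S]; [S := setT] gives the
   ideals of [A] itself. *)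
Definition is_ideal_of S J : Prop :=
  [/\ is_subspace J, J `<=` S &
      forall x y, J x -> S y -> J (mul x y) /\ J (mul y x)].

Definition is_ideal J : Prop := is_ideal_of setT J.

Definition ideal_gen c : set A := smallest is_ideal [set c].

(* The subalgebra [S], with the product of [A] restricted to it, is a simple
   algebra. *)
Definition simple_alg S : Prop :=
  (exists x y, [/\ S x, S y & mul x y != 0]) /\
  (forall J, is_ideal_of S J -> J = [set 0] \/ J = S).

Definition simple_ideal J : Prop := is_ideal J /\ simple_alg J.

(* [A] is the internal direct sum of the family [J].  Every type carries a
   choice structure classically, so the index type is arbitrary. *)
Definition is_direct_sum (I : choiceType) (J : I -> set A) : Prop :=
  forall x, exists! f : I -> A,
    [/\ forall i, J i (f i), finite_set [set i | f i != 0] &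
        x = \sum_(i \in [set: I]) f i].

Definition semisimple : Prop :=
  exists (I : choiceType) (J : I -> set A),
    (forall i, simple_ideal (J i)) /\ is_direct_sum J.

Definition Ann : set A := [set x | forall y, mul y x = 0 /\ mul x y = 0].

Definition S_ B u : set A :=
  [set v | B v /\ mul u v != 0] `|` [set v | B v /\ mul v u != 0].

Definition M_ B u : set A := lin_span (S_ B u).

Definition weak_division_basis B : Prop :=
  is_basis B /\
  forall u x c, B u -> M_ B u x -> c != 0 -> mul u x = c \/ mul x u = c ->
    ideal_gen c u /\ ideal_gen c x.

Definition P_ B u : set A :=
  [set v | B v /\ exists2 w, B w & coord B u (mul v w) != 0] `|`
  [set v | B v /\ exists2 w, B w & coord B u (mul w v) != 0].

Definition PP_ B u : set A :=
  [set b | exists v w, [/\ P_ B u v, P_ B u w & b = mul v w]].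

Definition semi_division_basis B : Prop :=
  weak_division_basis B /\
  forall u b v c, B u -> PP_ B u b -> S_ B u v -> c != 0 ->
    mul b v = c \/ mul v b = c ->
    ideal_gen c v /\ ideal_gen c b.

End Algebra.

(* Main.v *)
(* Call x and y adjacent when xy or yx is non-zero.

   If A is a direct sum of simple ideals J_i, a Zorn argument extracts a basis
   from the union of the J_i.  Since J_i J_j = 0 for i <> j, each of the
   products in the definition of a semi-division basis has both factors in a
   single J_i, and a non-zero element of J_i generates an ideal containing J_i.

   Conversely, weak division makes adjacent basis vectors generate the same
   ideal.  Let c be the product of two basis vectors, and let z be the part of
   c supported on the basis vectors w with I(w) <> I(c).  If z were non-zero,
   then, Ann(A) being 0, some basis vector v would be adjacent to z, hence to
   some such w, while v is adjacent to no w' with I(w') = I(c); so v is adjacent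
   to c itself, and semi-division gives I(c) = I(v) = I(w), a contradiction.
   Hence I(u) is the span of the basis vectors v with I(v) = I(u), these ideals
   annihilate each other, and A is the direct sum of the distinct ones.  If J is
   a non-zero ideal of I(u), an element x <> 0 of J is adjacent to a basis vector
   v; deleting from x the coordinates not adjacent to v, weak division yields
   v in J, hence J = I(u). *)
Require Import Defs.
From mathcomp Require Import all_boot all_order all_algebra.
From mathcomp Require Import mathcomp_extra boolp classical_sets functions.
From mathcomp Require Import cardinality fsbigop.
Local Open Scope classical_set_scope.
Local Open Scope ring_scope.

Set Implicit Arguments.
Unset Strict Implicit.
Unset Printing Implicit Defensive.

Import GRing.Theory.

(** * Finitely supported sums and chains of sets *)

Lemma fsbig_supp (T : choiceType) (V : zmodType) (D F : set T) (f : T -> V) :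
  finite_set F -> F `<=` D -> (forall i, D i -> f i != 0 -> F i) ->
  \sum_(i \in D) f i = \sum_(i <- finmap.enum_fset (fset_set F)) f i.
Proof.
move=> finF FD suppF; rewrite -fsbig_finite//; apply/esym/fsbig_widen => //.
by move=> i [Di nFi]; apply/eqP; apply: contrapT => /negP/(suppF i Di).
Qed.

Lemma fsbig_suppT (T : choiceType) (V : zmodType) (F : set T) (f : T -> V) :
  finite_set F -> (forall i, f i != 0 -> F i) ->
  \sum_(i \in [set: T]) f i = \sum_(i <- finmap.enum_fset (fset_set F)) f i.
Proof. by move=> finF suppF; apply: fsbig_supp => // i _; apply: suppF. Qed.

Lemma addr_neq0 (V : zmodType) (x y : V) : x + y != 0 -> x != 0 \/ y != 0.
Proof. by have [->|] := eqVneq x 0; [rewrite add0r; right|left]. Qed.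

Lemma fsbig_delta (T : choiceType) (V : zmodType) (k : T) (x : V) :
  let d i := if i == k then x else 0 in
  finite_set [set i | d i != 0] /\ x = \sum_(i \in [set: T]) d i.
Proof.
move=> d; have dk i : d i != 0 -> [set k] i.
  by rewrite /d /=; have [//|_] := eqVneq i k; rewrite eqxx.
split; first exact: (sub_finite_set dk).
by rewrite (fsbig_suppT _ dk)// fset_set1 finmap.big_seq_fset1 /d eqxx.
Qed.

(** Induction on the elements of [S]: of two members of the chain one contains the other, so it
    takes in the new element as well. [X0] covers an empty [S]. *)
Lemma finite_sub_chain (T : choiceType) (F : set (set T)) (X0 S : set T) :
  total_on F subset -> F X0 -> finite_set S -> S `<=` \bigcup_(X in F) X ->
  exists2 X, F X & S `<=` X.
Proof.
move=> Ftot FX0 finS SF.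
suff [X FX sX] : exists2 X, F X & forall s, s \in finmap.enum_fset (fset_set S) -> X s.
  by exists X => // s Ss; apply: sX; rewrite in_fset_set// inE.
have: forall s, s \in finmap.enum_fset (fset_set S) -> (\bigcup_(X in F) X) s.
  by move=> s; rewrite in_fset_set// inE; apply: SF.
elim: (finmap.enum_fset _) => [|s r IH] rF; first by exists X0.
have [X FX rX] : exists2 X, F X & forall s, s \in r -> X s.
  by apply: IH => t tr; apply: rF; rewrite inE tr orbT.
have [Y FY Ys] : (\bigcup_(X in F) X) s by apply: rF; rewrite inE eqxx.
have [XY|YX] := Ftot _ _ FX FY.
  by exists Y => // t; rewrite inE => /orP[/eqP->//|/rX/XY].
by exists X => // t; rewrite inE => /orP[/eqP->|/rX//]; apply: YX.
Qed.

(** * Subspaces, spans and extraction of a basis *)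

Section LinearAlgebra.
Variables (K : fieldType) (A : lmodType K).
Implicit Types (S T B : set A) (c : A -> K) (x y : A).

Lemma lin_span_subspace S : is_subspace (lin_span S).
Proof.
split=> [|x y Sx Sy|a x Sx] M MS; have [[M0 MD MZ] _] := MS => //.
- by apply: MD; [apply: Sx|apply: Sy].
- by apply: MZ; apply: Sx.
Qed.

Lemma sub_lin_span S : S `<=` lin_span S.
Proof. exact: sub_smallest. Qed.

Lemma lin_span_sub S T : is_subspace T -> S `<=` T -> lin_span S `<=` T.
Proof. exact: smallest_sub. Qed.

Lemma lin_spanS S T : S `<=` T -> lin_span S `<=` lin_span T.
Proof.
move=> ST; apply: lin_span_sub; first exact: lin_span_subspace.
by move=> x /ST; apply: sub_lin_span.
Qed.

Lemma subspaceN S x : is_subspace S -> S x -> S (- x).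
Proof. by move=> [_ _ SZ] Sx; rewrite -scaleN1r; apply: SZ. Qed.

Lemma subspaceB S x y : is_subspace S -> S x -> S y -> S (x - y).
Proof. by move=> sS Sx Sy; case: (sS) => _ + _; apply => //; apply: subspaceN. Qed.

Lemma subspace_sum (I : Type) (r : seq I) (P : pred I) S (f : I -> A) :
  is_subspace S -> (forall i, P i -> S (f i)) -> S (\sum_(i <- r | P i) f i).
Proof. by move=> [S0 SD _] Sf; apply: big_ind. Qed.

Lemma subspaceI S T : is_subspace S -> is_subspace T -> is_subspace (S `&` T).
Proof.
move=> [S0 SD SZ] [T0 TD TZ]; split=> //.
- by move=> x y [? ?] [? ?]; split; [apply: SD|apply: TD].
- by move=> a x [? ?]; split; [apply: SZ|apply: TZ].
Qed.

Lemma lin_span_split S T x : lin_span S x ->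
  exists y z, [/\ x = y + z, lin_span (S `&` T) y & lin_span (S `\` T) z].
Proof.
pose P := [set x | exists y z,
  [/\ x = y + z, lin_span (S `&` T) y & lin_span (S `\` T) z]].
have [I0 ID IZ] := lin_span_subspace (S `&` T).
have [D0 DD DZ] := lin_span_subspace (S `\` T).
apply: (lin_span_sub (T := P)) => [|u Su].
  split.
  - by exists 0, 0; rewrite addr0; split.
  - move=> _ _ [y [z [-> Sy Sz]]] [y' [z' [-> Sy' Sz']]].
    by exists (y + y'), (z + z'); rewrite addrACA; split; [|apply: ID|apply: DD].
  - move=> a _ [y [z [-> Sy Sz]]].
    by exists (a *: y), (a *: z); rewrite scalerDr; split; [|apply: IZ|apply: DZ].
have [Tu|nTu] := pselect (T u).
  by exists u, 0; rewrite addr0; split=> //; apply: sub_lin_span.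
by exists 0, u; rewrite add0r; split=> //; apply: sub_lin_span.
Qed.

(** Any finite set containing the support may index the sum, so that two combinations can be added
    over a common list. *)
Lemma lin_comb_seq B (F : set A) c x : finite_set F -> F `<=` B ->
  (forall v, c v != 0 -> F v) ->
  lin_comb B c x <-> x = \sum_(v <- finmap.enum_fset (fset_set F)) c v *: v.
Proof.
move=> finF FB cF; rewrite /lin_comb (@fsbig_supp _ _ _ F)//.
  by split=> [[]//|->]; split=> // [v /cF/FB//|]; apply: sub_finite_set finF.
by move=> v _ cv0; apply: cF; apply: contraNneq cv0 => ->; rewrite scale0r.
Qed.

Lemma lin_comb1 B u : B u -> lin_comb B (fun v => (v == u)%:R) u.
Proof.
move=> Bu; apply/(@lin_comb_seq _ [set u]) => //.
- by move=> v ->.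
- by move=> v /=; have [//|_] := eqVneq v u; rewrite mulr0n eqxx.
by rewrite fset_set1 finmap.big_seq_fset1 eqxx scale1r.
Qed.

Lemma lin_span_lin_comb B x : lin_span B x -> exists c, lin_comb B c x.
Proof.
apply: (lin_span_sub (T := [set x | exists c, lin_comb B c x])).
  split.
  - exists (fun=> 0); apply/(@lin_comb_seq _ set0) => //.
    + by move=> v; rewrite eqxx.
    + by rewrite big1// => v _; rewrite scale0r.
  - move=> y z [c cy] [d dz].
    have [cB cfin _] := cy; have [dB dfin _] := dz.
    pose F := [set v | c v != 0] `|` [set v | d v != 0].
    have finF : finite_set F by rewrite finite_setU.
    have FB : F `<=` B by rewrite subUset.
    move: cy dz => /(lin_comb_seq _ finF FB)-> => [|v ?]; last by left.
    move=> /(lin_comb_seq _ finF FB)-> => [|v ?]; last by right.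
    exists (fun v => c v + d v); apply/(lin_comb_seq _ finF FB).
      by move=> v /addr_neq0.
    by rewrite -big_split/=; apply: eq_bigr => v _; rewrite scalerDl.
  - move=> a y [c cy]; have [cB cfin _] := cy.
    move: cy => /(lin_comb_seq _ cfin cB)-> => [|//].
    exists (fun v => a * c v); apply/(lin_comb_seq _ cfin cB).
      by move=> v; apply: contraNneq => ->; rewrite mulr0.
    by rewrite scaler_sumr; apply: eq_bigr => v _; rewrite scalerA.
by move=> u Bu; exists (fun v => (v == u)%:R); apply: lin_comb1.
Qed.

Lemma lin_comb_coord B x : lin_span B x -> lin_comb B (Defs.coord B ^~ x) x.
Proof. by move=> /lin_span_lin_comb/(xgetPex (fun=> 0)). Qed.

(** Keeping only the non-zero coordinates is what later places the factors of a product in [P_]. *)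
Lemma lin_span_coord B x : lin_span B x ->
  lin_span [set v | B v /\ Defs.coord B v x != 0] x.
Proof.
move=> /lin_comb_coord[cB cfin {2}->]; rewrite (fsbig_supp cfin cB).
  rewrite big_seq; apply: subspace_sum; first exact: lin_span_subspace.
  move=> v; rewrite in_fset_set// inE/= => cv.
  have [_ _] := lin_span_subspace [set v | B v /\ Defs.coord B v x != 0]; apply.
  by apply: sub_lin_span; split=> //; apply: cB.
by move=> v _; apply: contraNneq => ->; rewrite scale0r.
Qed.

Lemma lin_indep_neq0 B u : lin_indep B -> B u -> u != 0.
Proof.
move=> indB /lin_comb1 cu; apply/eqP => u0; move: cu; rewrite {2}u0.
by move=> /indB/(congr1 (@^~ u)) /=; rewrite eqxx => /eqP; rewrite oner_eq0.
Qed.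

(** If the coefficient of [h] vanishes, the relation lives on [B]; otherwise dividing by it puts [h]
    in the span of [B]. *)
Lemma lin_indepU1 B h : lin_indep B -> ~ lin_span B h -> lin_indep (h |` B).
Proof.
move=> indB Bh c hc; have [cB cfin _] := hc.
have sum0 := (lin_comb_seq 0 cfin cB (fun=> id)).1 hc.
have [ch0|ch0] := eqVneq (c h) 0.
  apply: indB; apply/(lin_comb_seq _ cfin) => // v /= cv.
  by have [vh|//] := cB v cv; rewrite vh ch0 eqxx in cv.
exfalso; apply: Bh; have sB := lin_span_subspace B.
move: sum0; rewrite (bigD1_seq h)/= ?finmap.fset_uniq//; last first.
  by rewrite in_fset_set// inE.
move=> /eqP; rewrite eq_sym addr_eq0 => /eqP chE.
have -> : h = (c h)^-1 *: (c h *: h) by rewrite scalerA mulVf// scale1r.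
have [_ _ BZ] := sB; apply: (BZ); rewrite chE; apply: (subspaceN sB).
rewrite big_seq_cond; apply: subspace_sum => // v /andP[].
rewrite in_fset_set// inE => /= /cB[->|Bv _]; first by rewrite eqxx.
by apply: BZ; apply: sub_lin_span.
Qed.

(** Zorn's lemma gives a maximal independent subset of [H]; any vector of [H] outside its span could
    be added to it. *)
Lemma exists_basis_sub (H : set A) : lin_span H = setT ->
  exists2 B, B `<=` H & is_basis B.
Proof.
move=> HT; have := @Zorn_bigcup A [set B | B `<=` H /\ lin_indep B].
move=> [F FP Ftot|B [[BH indB] maxB]].
  split=> [x [X /FP[XH _]]|c hc]; first exact: XH.
  have [cF cfin _] := hc.
  (* An empty chain has empty union, which forces [c] to have empty support. *)
  have [[X0 FX0]|F0] := pselect (exists X, F X); last first.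
    apply/funext => v; apply/eqP; apply: contrapT => /negP/cF[X FX _].
    by apply: F0; exists X.
  have [X FX cX] := finite_sub_chain Ftot FX0 cfin cF.
  have [_ indX] := FP X FX; apply: indX.
  by apply/(lin_comb_seq _ cfin) => //; apply/(lin_comb_seq _ cfin cF).
exists B => //; split=> //; apply/seteqP; split=> // x _.
have: lin_span H x by rewrite HT.
apply: lin_span_sub; first exact: lin_span_subspace.
move=> h Hh; apply: contrapT => Bh; apply: (maxB (h |` B)).
  by split=> [|hB]; [exact: subsetUr|apply: Bh; apply: sub_lin_span; apply: hB; left].
by split; [rewrite subUset; split=> // _ ->|apply: lin_indepU1].
Qed.

End LinearAlgebra.

(** * Adjacency and generated ideals *)

Section Algebra.
Variables (K : fieldType) (A : lmodType K) (mul : {bilinear A -> A -> A}).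
Implicit Types (S J B : set A) (u v x y c : A).

Definition adj x y : Prop := mul x y != 0 \/ mul y x != 0.

Lemma adjC x y : adj x y -> adj y x.
Proof. by case; [right|left]. Qed.

Lemma not_adj x y : ~ adj x y -> mul x y = 0 /\ mul y x = 0.
Proof. by move=> /not_orP[/negP/negPn/eqP-> /negP/negPn/eqP->]. Qed.

Lemma not_adjP x y : mul x y = 0 -> mul y x = 0 -> ~ adj x y.
Proof. by move=> xy yx; case; rewrite ?xy ?yx eqxx. Qed.

Lemma not_adj0 y : ~ adj 0 y.
Proof. by apply: not_adjP; rewrite ?linear0l ?linear0. Qed.

(** Being annihilated by [y] on both sides is a linear condition; hence a vector adjacent to [y] has
    an adjacent generator in any set spanning it. *)
Lemma not_adj_subspace y : is_subspace [set x | ~ adj x y].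
Proof.
split=> [|x z /not_adj[xy yx] /not_adj[zy yz]|a x /not_adj[xy yx]] /=.
  exact: not_adj0.
all: apply: not_adjP.
- by rewrite linearDl xy zy addr0.
- by rewrite linearD/= yx yz addr0.
- by rewrite linearZl_LR xy scaler0.
- by rewrite linearZ/= yx scaler0.
Qed.

Lemma adj_span S x y : lin_span S x -> adj x y -> exists2 s, S s & adj s y.
Proof.
move=> Sx axy; apply: contrapT => nS.
have: [set x | ~ adj x y] x.
  apply: lin_span_sub Sx; first exact: not_adj_subspace.
  by move=> s Ss asy; apply: nS; exists s.
exact.
Qed.

Lemma adj_addr x z y : ~ adj z y -> adj x y -> adj (x + z) y.
Proof. by move=> /not_adj[zy yz]; rewrite /adj linearDl linearD/= zy yz !addr0. Qed.

Lemma adj_addr_inv x z y : ~ adj z y -> adj (x + z) y -> adj x y.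
Proof. by move=> /not_adj[zy yz]; rewrite /adj linearDl linearD/= zy yz !addr0. Qed.

Lemma adj_prod x y : adj x y -> exists2 c, c != 0 & mul x y = c \/ mul y x = c.
Proof. by case=> ?; [exists (mul x y)|exists (mul y x)] => //; [left|right]. Qed.

Lemma ideal_gen_ideal c : is_ideal mul (ideal_gen mul c).
Proof.
split=> [||x y xc _] //.
- split=> [|x y xc yc|a x xc] M Mc; have [[[M0 MD MZ] _ _] _] := Mc => //.
  + by apply: MD; [apply: xc|apply: yc].
  + by apply: MZ; apply: xc.
- by split=> M Mc; have [[_ _ MM] _] := Mc; have [] := MM x y (xc M Mc) I.
Qed.

Lemma ideal_gen_id c : ideal_gen mul c c.
Proof. by move=> M [_]; apply. Qed.
Arguments ideal_gen_id : clear implicits.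

Lemma ideal_gen_sub c J : is_ideal mul J -> J c -> ideal_gen mul c `<=` J.
Proof. by move=> iJ Jc; apply: smallest_sub => // _ ->. Qed.

Lemma ideal_prod J x y c : is_ideal mul J -> J x ->
  mul x y = c \/ mul y x = c -> J c.
Proof. by move=> [_ _ JM] Jx; have [? ?] := JM x y Jx I; case=> <-. Qed.

Lemma ideal_gen_eq u c : ideal_gen mul u c -> ideal_gen mul c u ->
  ideal_gen mul c = ideal_gen mul u.
Proof.
move=> uc cu; apply/seteqP.
by split; apply: ideal_gen_sub => //; apply: ideal_gen_ideal.
Qed.

(** Every summand other than [f i] is annihilated by [y] on both sides, so the products of the sum
    with [y] are those of [f i]. *)
Lemma orthogonal_adj_sum (I : choiceType) (J : I -> set A) (f : I -> A) i y :
  (forall j k x z, j != k -> J j x -> J k z -> ~ adj x z) ->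
  (forall j, J j (f j)) -> finite_set [set j | f j != 0] ->
  J i y -> adj (f i) y -> adj (\sum_(j \in [set: I]) f j) y.
Proof.
move=> orth Jf finf Jy fy; rewrite (fsbig_suppT finf)//.
have fi0 : f i != 0.
  by apply/eqP => fi0; move: fy; rewrite fi0; apply: not_adj0.
rewrite (bigD1_seq i)/= ?finmap.fset_uniq//; last by rewrite in_fset_set// inE.
apply: adj_addr => //.
apply: (subspace_sum _ (not_adj_subspace y)).
by move=> j ji; apply: orth ji _ _.
Qed.

(** The vectors of [S] annihilated by all of [S] form an ideal [N] of [S]; as the product of [S] is
    non-zero, [N] is not [S], so it is zero. *)
Lemma simple_alg_ann S x : is_subspace S -> (forall x y, S x -> S y -> S (mul x y)) ->
  simple_alg mul S -> S x -> x != 0 -> exists2 y, S y & adj x y.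
Proof.
move=> sS SM [[a [b [Sa Sb ab0]]] simS] Sx x0.
apply: contrapT => nS.
pose N := S `&` [set x | forall y, S y -> ~ adj x y].
have Nid : is_ideal_of mul S N.
  split=> [||y z [Sy Ny] Sz]; [|by move=> y []|].
    apply: subspaceI => //; split.
    - by move=> y _; apply: not_adj0.
    - move=> z t Nz Nt y Sy; have [_ + _] := not_adj_subspace y.
      by apply; [apply: Nz|apply: Nt].
    - by move=> k z Nz y Sy; have [_ _] := not_adj_subspace y; apply; apply: Nz.
  have [-> ->] := not_adj (Ny z Sz).
  by have [S0 _ _] := sS; split; split=> // t _; apply: not_adj0.
have [N0|NS] := simS N Nid.
  have: N x by split=> // y Sy xy; apply: nS; exists y.
  by rewrite N0 => /= x0'; rewrite x0' eqxx in x0.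
have: N a by rewrite NS.
by move=> [_ /(_ b Sb)]; apply; left.
Qed.

(** * From a decomposition into simple ideals to a semi-division basis *)

Section DirectSum.
Variables (I : choiceType) (J : I -> set A).
Hypotheses (simJ : forall i, simple_ideal mul (J i)) (sumJ : is_direct_sum J).

Let idealJ i : is_ideal mul (J i). Proof. by have [] := simJ i. Qed.

Let subspaceJ i : is_subspace (J i). Proof. by have [] := idealJ i. Qed.

(** Placing [x] at index [i] or at index [j] gives two decompositions of [x], equal by
    uniqueness. *)
Lemma direct_sum_disjoint i j x : J i x -> J j x -> x != 0 -> i = j.
Proof.
move=> Jix Jjx x0; apply/eqP; apply: contrapT => /negP ij.
have [f [_ fU]] := sumJ x.
pose d (k l : I) := if l == k then x else 0.
have dP k : J k x -> [/\ forall l, J l (d k l), finite_set [set l | d k l != 0] &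
    x = \sum_(l \in [set: I]) d k l].
  move=> Jk; have [dfin dE] := fsbig_delta k x; split=> // l.
  rewrite /d; case: eqVneq => [->//|_].
  by have [] := subspaceJ l.
have := congr1 (@^~ i) (etrans (esym (fU _ (dP i Jix))) (fU _ (dP j Jjx))).
by rewrite /d eqxx (negPf ij) => x0'; rewrite x0' eqxx in x0.
Qed.

Lemma direct_sum_adj i j x y : J i x -> J j y -> adj x y -> i = j.
Proof.
move=> Jx Jy /adj_prod[c c0 xyc]; apply: (@direct_sum_disjoint _ _ c) => //.
  exact: (ideal_prod (idealJ i) Jx xyc).
by apply: (ideal_prod (idealJ j) Jy (y := x)); case: xyc => <-; [right|left].
Qed.

(** The ideal generated by [c] meets [J i] in a non-zero ideal of [J i]. *)
Lemma simple_sub_ideal_gen i c : J i c -> c != 0 -> J i `<=` ideal_gen mul c.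
Proof.
move=> Jc c0; have [_ [_ simJi]] := simJ i.
have [sc _ cM] := ideal_gen_ideal c; have [_ _ JM] := idealJ i.
have : is_ideal_of mul (J i) (ideal_gen mul c `&` J i).
  split=> [||x y [cx Jx] Jy]; [exact: subspaceI|by move=> x []|].
  have [? ?] := cM x y cx Logic.I; have [? ?] := JM x y Jx Logic.I.
  by split; split.
move=> /simJi[E|E]; last by rewrite -E => x [].
have : (ideal_gen mul c `&` J i) c by split=> //; apply: ideal_gen_id.
by rewrite E => /= c0'; rewrite c0' eqxx in c0.
Qed.

(** A non-zero component [f i] of [x] is adjacent to some [y] in [J i], and the other components do
    not change the products with [y]. *)
Lemma direct_sum_Ann : Ann mul = [set 0].
Proof.
apply/seteqP; split=> [x annx|_ -> y]; last by rewrite linear0 linear0l.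
have [f [[Jf finf xE] _]] := sumJ x.
rewrite /= xE fsbig1// => i _; apply/eqP; apply: contrapT => /negP fi0.
have [y Jy fy] : exists2 y, J i y & adj (f i) y.
  apply: simple_alg_ann fi0 => //; last by have [] := simJ i.
  by move=> a b Ja _; apply: (ideal_prod (idealJ i) Ja (y := b)); left.
have : adj x y.
  rewrite xE; apply: orthogonal_adj_sum Jy fy => // j k a b jk Ja Jb.
  by move=> /(direct_sum_adj Ja Jb)/eqP; apply/negP.
by have [? ?] := annx y; apply: not_adjP.
Qed.

Lemma direct_sum_basis : exists2 B, B `<=` \bigcup_(i in [set: I]) J i & is_basis B.
Proof.
apply: exists_basis_sub; apply/seteqP; split=> // x _.
have [f [[Jf finf ->] _]] := sumJ x.
rewrite (fsbig_suppT finf)//; apply: subspace_sum; first exact: lin_span_subspace.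
by move=> i _; apply: sub_lin_span; exists i.
Qed.

Lemma homogeneous_semi_division B : B `<=` \bigcup_(i in [set: I]) J i ->
  is_basis B -> semi_division_basis mul B.
Proof.
move=> BJ basB.
have genJ i x y c : J i x -> J i y -> c != 0 -> mul x y = c \/ mul y x = c ->
    ideal_gen mul c x /\ ideal_gen mul c y.
  move=> Jx Jy c0 xyc; have Jc := ideal_prod (idealJ i) Jx xyc.
  by split; apply: (simple_sub_ideal_gen Jc c0).
split.
  split=> // u x c Bu Mx c0 uxc; have [i _ Ju] := BJ u Bu.
  (* The whole of [M_ mul B u] lies in [J i]: its generators are basis vectors adjacent to [u],
     hence in the same summand. *)
  apply: (genJ i) uxc => //; apply: lin_span_sub Mx => // v Sv.
  have [Bv uv] : B v /\ adj u v by case: Sv => -[]; split=> //; [left|right].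
  by have [k _ Jv] := BJ v Bv; rewrite (direct_sum_adj Ju Jv uv).
move=> u b v c Bu [w [w' [Pw _ bE]]] Sv c0 bvc.
have Bw : B w by case: Pw => -[].
have Bv : B v by case: Sv => -[].
have [i _ Jw] := BJ w Bw; have [j _ Jv] := BJ v Bv.
have Jb : J i b by rewrite bE; apply: (ideal_prod (idealJ i) Jw (y := w')); left.
have bv : adj b v by case: bvc => E; [left|right]; rewrite E.
have ij := direct_sum_adj Jb Jv bv; rewrite -ij in Jv.
by apply: (genJ i) => //; case: bvc; [right|left].
Qed.

End DirectSum.

(** * From a semi-division basis to a decomposition into simple ideals *)

Section SemiDivision.
Variable B : set A.
Hypotheses (Ann0 : Ann mul = [set 0]) (semiB : semi_division_basis mul B).

Local Notation "<( c )>" := (ideal_gen mul c) (format "<( c )>").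

Let spanB : lin_span B = setT. Proof. by have [[[]]] := semiB. Qed.

Let indB : lin_indep B. Proof. by have [[[]]] := semiB. Qed.

Lemma exists_adj_basis x : x != 0 -> exists2 v, B v & adj x v.
Proof.
move=> x0; have [y xy] : exists y, adj x y.
  apply: contrapT => nx; suff: Ann mul x by rewrite Ann0 => /= E; rewrite E eqxx in x0.
  by move=> y; have [] := @not_adj x y (fun a => nx (ex_intro _ y a)).
have [v Bv /adjC vx] : exists2 v, B v & adj v x.
  by apply: adj_span (adjC xy); rewrite spanB.
by exists v.
Qed.

Lemma S_P u v : S_ mul B u v <-> B v /\ adj u v.
Proof.
split=> [[[Bv uv]|[Bv vu]]|[Bv [uv|vu]]]; [ | |by left|by right].
  by split=> //; left.
by split=> //; right.
Qed.

Lemma adj_weak u x : B u -> M_ mul B u x -> adj u x ->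
  exists2 c, mul u x = c \/ mul x u = c & <(c)> u /\ <(c)> x.
Proof.
move=> Bu Mx /adj_prod[c c0 uxc]; exists c => //.
by have [[_ weakB] _] := semiB; apply: (weakB u x).
Qed.

(** Weak division puts [u] and [v] in the ideal of [c]; conversely [c], being their product, lies in
    the ideal of each. *)
Lemma prod_ideal_gen u v c : B u -> B v -> c != 0 -> mul u v = c \/ mul v u = c ->
  <(c)> = <(u)> /\ <(c)> = <(v)>.
Proof.
move=> Bu Bv c0 uvc; have [[_ weakB] _] := semiB.
have [] // := weakB u v c Bu _ c0 uvc.
  apply: sub_lin_span; apply/S_P; split=> //.
  by case: uvc => E; [left|right]; rewrite E.
move=> cu cv; split; apply: ideal_gen_eq => //.
  exact: (ideal_prod (ideal_gen_ideal u) (ideal_gen_id u) uvc).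
apply: (ideal_prod (ideal_gen_ideal v) (ideal_gen_id v) (y := u)).
by case: uvc; [right|left].
Qed.

Lemma adj_ideal_gen u v : B u -> B v -> adj u v -> <(u)> = <(v)>.
Proof.
by move=> Bu Bv /adj_prod[c c0 /(prod_ideal_gen Bu Bv c0)[<-]].
Qed.

(** The base point [u] need not belong to [B]: the class of a product of basis vectors is also
    used. *)
Definition ideal_class u := [set v | B v /\ <(v)> = <(u)>].

(** The second clause of semi-division enters here, applied to the product [c] and a basis vector
    [v']. *)
Lemma mul_basis_class u v : B u -> B v -> mul u v != 0 ->
  lin_span (ideal_class (mul u v)) (mul u v).
Proof.
move=> Bu Bv c0; set c := mul u v in c0 *.
have cB : lin_span B c by rewrite spanB.
have [y [z [cE yC zC]]] := lin_span_split [set w | <(w)> = <(c)>] (lin_span_coord cB).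
suff z0 : z = 0.
  rewrite {2}cE z0 addr0; apply: lin_spanS yC => w [[Bw _] wc]; by split.
apply/eqP; apply: contrapT => /negP/exists_adj_basis[v' Bv' zv'].
have [w [[Bw cw] /= nwc] wv'] := adj_span zC zv'.
have yv' : ~ adj y v'.
  move=> /(adj_span yC)[w' [[Bw' _] /= w'c] w'v']; apply: nwc.
  by rewrite (adj_ideal_gen Bw Bv' wv') -(adj_ideal_gen Bw' Bv' w'v').
have : adj c v' by rewrite cE addrC; apply: adj_addr.
move=> /adj_prod[d d0 cv'd]; have [_ semi] := semiB.
(* [w] has a non-zero coordinate in [c], the product of [u] and [v], so both factors are in
   [P_ mul B w]. *)
have PPc : PP_ mul B w c.
  by exists u, v; split=> //; [left|right]; split=> //; [exists v|exists u].
have [] // := semi w c v' d Bw PPc _ d0 cv'd; first exact/S_P.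
(* The ideal of [d] equals that of [v'], hence of [w], and also that of [c]. *)
move=> dv' dc; apply: nwc; rewrite (adj_ideal_gen Bw Bv' wv').
rewrite -(@ideal_gen_eq v' d)//.
  apply: ideal_gen_eq => //.
  exact: (ideal_prod (ideal_gen_ideal c) (ideal_gen_id c) cv'd).
apply: (ideal_prod (ideal_gen_ideal v') (ideal_gen_id v') (y := c)).
by case: cv'd; [right|left].
Qed.

(** By bilinearity it is enough to multiply two basis vectors, one of them in the class; a non-zero
    product generates the same ideal as either factor, so [mul_basis_class] applies. *)
Lemma class_span_ideal u : is_ideal mul (lin_span (ideal_class u)).
Proof.
have sC := lin_span_subspace (ideal_class u); have [C0 CD CZ] := sC.
split=> // x y Cx _.
have By : lin_span B y by rewrite spanB.
pose T y := [set x | lin_span (ideal_class u) (mul x y) /\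
                     lin_span (ideal_class u) (mul y x)].
have Tsub z : is_subspace (T z).
  split=> [|a b [? ?] [? ?]|k a [? ?]]; rewrite /T/=.
  - by rewrite linear0l linear0.
  - by rewrite linearDl linearD/=; split; apply: CD.
  - by rewrite linearZl_LR linearZ/=; split; apply: CZ.
suff: T x y by case.
apply: lin_span_sub (Tsub x) _ _ By => v Bv; suff: T v x by case.
apply: lin_span_sub (Tsub v) _ _ Cx => w [Bw wu].
have prodC a b : B a -> B b -> <(a)> = <(u)> \/ <(b)> = <(u)> ->
    lin_span (ideal_class u) (mul a b).
  move=> Ba Bb abu; have [->//|c0] := eqVneq (mul a b) 0.
  have [ca cb] := prod_ideal_gen Ba Bb c0 (or_introl erefl).
  have cu : <(mul a b)> = <(u)> by case: abu => <-.
  by have := mul_basis_class Ba Bb c0; rewrite /ideal_class cu.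
by split; apply: prodC => //; [left|right].
Qed.

(** The span is an ideal containing [u], and each member of the class lies in the ideal of [u],
    which it generates. *)
Lemma ideal_gen_class_span u : B u -> <(u)> = lin_span (ideal_class u).
Proof.
move=> Bu; apply/seteqP; split.
  by apply: ideal_gen_sub (class_span_ideal u) _; apply: sub_lin_span.
apply: lin_span_sub; first by have [] := ideal_gen_ideal u.
by move=> v [_ <-]; apply: ideal_gen_id.
Qed.

Lemma adj_ideals u v x y : B u -> B v -> <(u)> x -> <(v)> y -> adj x y ->
  <(u)> = <(v)>.
Proof.
move=> Bu Bv ux vy; rewrite ideal_gen_class_span// in ux.
rewrite ideal_gen_class_span// in vy.
move=> /(adj_span ux)[w [Bw <-]] /adjC /(adj_span vy)[w' [Bw' <-]] /adjC.
exact: adj_ideal_gen.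
Qed.

Lemma ideal_gen_simple u : B u -> simple_ideal mul <(u)>.
Proof.
move=> Bu; split; first exact: ideal_gen_ideal.
have u0 := lin_indep_neq0 indB Bu.
split.
  have [v Bv uv] := exists_adj_basis u0.
  have vu : <(u)> v by rewrite (adj_ideal_gen Bu Bv uv); apply: ideal_gen_id.
  have uu := ideal_gen_id u.
  by case: uv => ?; [exists u, v|exists v, u].
move=> J [sJ Ju JM].
have [J0|/existsNP[x]] := pselect (forall x, J x -> x = 0).
  by left; apply/seteqP; split=> [x /J0//|_ ->]; have [] := sJ.
move=> /not_implyP[Jx /eqP x0]; right; apply/seteqP; split=> //.
have [_ JD _] := sJ.
(* [J] is only given as an ideal of [<(u)>]. It absorbs any [b] in [A] because the part of [b]
   outside the class of [u] annihilates it. *)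
have iJ : is_ideal mul J.
  split=> // a b Ja _; have Bb : lin_span B b by rewrite spanB.
  have [y [z [-> yC zC]]] := lin_span_split (ideal_class u) Bb.
  have az : ~ adj z a.
    move=> /(adj_span zC)[w [Bw nw] wa]; apply: nw; split=> //.
    by apply: adj_ideals wa => //; [apply: ideal_gen_id|apply: Ju].
  have [za az'] := not_adj az; rewrite linearDl linearD/= za az' !addr0.
  apply: JM => //; rewrite ideal_gen_class_span//.
  by apply: lin_spanS yC => w [].
have [v Bv xv] := exists_adj_basis x0.
have vu : <(u)> = <(v)>.
  by apply: adj_ideals xv => //; [apply: Ju|apply: ideal_gen_id].
suff Jv : J v by rewrite vu; apply: ideal_gen_sub.
have Bx : lin_span B x by rewrite spanB.
(* Weak division speaks only of vectors in [M_ mul B v]. The part [y] of [x] on basis vectors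
   adjacent to [v] is one, and it has the same products with [v] as [x], so these products stay in
   [J]. *)
have [y [z [xE yC zC]]] := lin_span_split (adj v) Bx.
have zv : ~ adj z v.
  by move=> /(adj_span zC)[w [_ nw] wv]; apply: nw; apply: adjC.
have yv : adj v y by apply: adjC; apply: adj_addr_inv zv _; rewrite -xE.
have [|c vyc [cv _]] := adj_weak Bv _ yv.
  by apply: lin_spanS yC => w [Bw vw]; apply/S_P.
have [zv0 vz0] := not_adj zv.
suff Jc : J c by apply: (ideal_gen_sub iJ Jc).
apply: (ideal_prod iJ Jx (y := v)); rewrite xE linearDl linearD/= zv0 vz0 !addr0.
by case: vyc; [right|left].
Qed.

(** Indexing by the ideals themselves, not by basis vectors, counts each summand once. *)
Definition basis_ideals : set (set A) := [set <(u)> | u in B].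

(** Existence: the decomposable vectors form a subspace containing [B]. Uniqueness: a non-zero
    component of the difference of two decompositions would be adjacent to some basis vector [v],
    and then so would the sum of the differences, which is 0. *)
Lemma basis_ideals_direct_sum :
  is_direct_sum (fun i : basis_ideals => \val i : set A).
Proof.
pose J (i : basis_ideals) : set A := \val i.
have JP i : exists2 u, B u & J i = <(u)>.
  by have [u Bu iu] := set_mem (valP i); exists u.
have sJ i : is_subspace (J i).
  by have [u _ ->] := JP i; have [] := ideal_gen_ideal u.
have orth i j x y : i != j -> J i x -> J j y -> ~ adj x y.
  move=> /eqP ij; have [u Bu iu] := JP i; have [v Bv jv] := JP j.
  rewrite iu jv => ux vy /(adj_ideals Bu Bv ux vy) uv; apply: ij.
  by apply: val_inj; rewrite [LHS]iu uv -jv.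
pose P := [set x | exists f : basis_ideals -> A,
  [/\ forall i, J i (f i), finite_set [set i | f i != 0] &
      x = \sum_(i \in [set: basis_ideals]) f i]].
have PT x : P x.
  have Bx : lin_span B x by rewrite spanB.
  apply: lin_span_sub Bx.
    split.
    - exists (fun=> 0); split.
      + by move=> i; have [] := sJ i.
      + by rewrite (_ : mkset _ = set0)//; apply/seteqP; split=> // i; rewrite /= eqxx.
      + by rewrite fsbig1.
    - move=> _ _ [f [Jf ff ->]] [g [Jg gf ->]].
      pose F := [set i | f i != 0] `|` [set i | g i != 0].
      have finF : finite_set F by rewrite finite_setU.
      have fgF i : f i + g i != 0 -> F i by move=> /addr_neq0.
      exists (fun i => f i + g i); split.
      + by move=> i; have [_ + _] := sJ i; apply.
      + exact: sub_finite_set finF.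
      + rewrite !(fsbig_suppT finF) ?big_split//.
        * by move=> i ?; right.
        * by move=> i ?; left.
    - move=> a _ [f [Jf ff ->]].
      have af i : a *: f i != 0 -> [set i | f i != 0] i.
        by apply: contraNneq => ->; rewrite scaler0.
      exists (fun i => a *: f i); split.
      + by move=> i; have [_ _] := sJ i; apply.
      + exact: (sub_finite_set af).
      + by rewrite !(fsbig_suppT ff)// scaler_sumr.
  move=> u Bu; have iu : <(u)> \in basis_ideals by rewrite inE; exists u.
  pose i0 : basis_ideals := SigSub iu.
  have [dfin dE] := fsbig_delta i0 u.
  exists (fun i => if i == i0 then u else 0); split=> // i.
  case: eqVneq => [->|_]; first exact: ideal_gen_id.
  by have [] := sJ i.
move=> x; have [f [Jf ff xf]] := PT x; exists f; split=> // g [Jg gf xg].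
apply/funext => i; apply/eqP; rewrite -subr_eq0; apply: contrapT => /negP fgi.
pose d i := f i - g i; have Jd j : J j (d j) by exact: subspaceB (sJ j) (Jf j) (Jg j).
pose F := [set i | f i != 0] `|` [set i | g i != 0].
have finF : finite_set F by rewrite finite_setU.
have dF j : d j != 0 -> F j.
  by move=> /addr_neq0; rewrite oppr_eq0.
have [v Bv dv] := exists_adj_basis fgi.
(* [d i] lies in [<(u)>] and is adjacent to [v], so [u] and [v] generate the same ideal. *)
have Jv : J i v.
  have [u Bu iu] := JP i; rewrite iu.
  by rewrite (@adj_ideals u v (d i) v)// -?iu//; apply: ideal_gen_id.
have := orthogonal_adj_sum orth Jd (sub_finite_set dF finF) Jv dv.
rewrite (fsbig_suppT finF)// /d sumrB -!(fsbig_suppT finF).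
- by rewrite -xf -xg subrr; apply: not_adj0.
- by move=> j ?; right.
- by move=> j ?; left.
Qed.

End SemiDivision.

End Algebra.

Theorem theorem1 (K : fieldType) (A : lmodType K)
    (mul : {bilinear A -> A -> A}) :
  semisimple mul <->
  Ann mul = [set 0] /\ exists B : set A, semi_division_basis mul B.
Proof.
split=> [[I [J [simJ sumJ]]]|[Ann0 [B semiB]]].
  split; first exact: direct_sum_Ann simJ sumJ.
  have [B BJ basB] := direct_sum_basis sumJ.
  by exists B; apply: homogeneous_semi_division BJ basB.
exists (basis_ideals mul B), (fun i => \val i); split.
  by move=> i; have [u Bu <-] := set_mem (valP i); apply: ideal_gen_simple semiB _ _.
exact: basis_ideals_direct_sum.
Qed.
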